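(* Let $n\geq 1$. Then $\mathcal{M}(\mathbb{A}_1;\mathbb{A}_n)=S(\mathrm{Im}(\mathbb{A}_n))=S^{2^n-2}$, where $S(\mathrm{Im}(\mathbb{A}_n))=\{w\in \mathrm{Im}(\mathbb{A}_n) : \|w\|=1\}$ is the unit sphere of the Euclidean space $\mathrm{Im}(\mathbb{A}_n)\cong\mathbb{R}^{2^n-1}$. Here the first equality means that the map $\varphi\mapsto\varphi(e_1)$ is a bijection from $\mathcal{M}(\mathbb{A}_1;\mathbb{A}_n)$ onto $S(\mathrm{Im}(\mathbb{A}_n))$.
   Context: The Cayley-Dickson algebras $\mathbb{A}_n=\mathbb{R}^{2^n}$ ($n\geq 0$) are the real algebras defined recursively by $\mathbb{A}_0=\mathbb{R}$ with trivial conjugation $\overline{x}=x$, and $\mathbb{A}_{n+1}=\mathbb{A}_n\times\mathbb{A}_n$ with product $(a,b)(x,y)=(ax-\overline{y}b,\;ya+b\overline{x})$ and conjugation $\overline{(x,y)}=(\overline{x},-y)$. The canonical basis of $\mathbb{A}_n=\mathbb{R}^{2^n}$ is denoted $e_0,e_1,\ldots,e_{2^n-1}$; recursively, the basis of $\mathbb{A}_{n+1}$ is $(e_0,0),\ldots,(e_{2^n-1},0),(0,e_0),\ldots,(0,e_{2^n-1})$ in this order. The element $e_0$ is the unit. The norm $\|\cdot\|$ and inner product $\langle\cdot,\cdot\rangle$ are the standard Euclidean ones on $\mathbb{R}^{2^n}$. $\mathrm{Im}(\mathbb{A}_n)=\{e_0\}^\perp$ is the subspace of pure elements. For $1\leq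 m\leq n$, an algebra monomorphism $\varphi:\mathbb{A}_m\to\mathbb{A}_n$ is an injective $\mathbb{R}$-linear map with $\varphi(e_0)=e_0$ and $\varphi(xy)=\varphi(x)\varphi(y)$ for all $x,y\in\mathbb{A}_m$. $\mathcal{M}(\mathbb{A}_m;\mathbb{A}_n)$ denotes the set of all algebra monomorphisms $\mathbb{A}_m\to\mathbb{A}_n$. *)

(* Defs.v *)
From HB Require Import structures.
From mathcomp Require Import all_boot all_order all_algebra.
From mathcomp Require Import classical_sets functions reals.

Set Implicit Arguments.
Unset Strict Implicit.
Unset Printing Implicit Defensive.

Import Order.TTheory GRing.Theory Num.Theory.
Local Open Scope classical_set_scope.
Local Open Scope ring_scope.

(* A_n = R^(2^n); a notation, so that the vector space structure of row
   vectors is available on it. *)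
Notation CD R n := 'rV[R]_(2 ^ n) (only parsing).

Lemma expn2S (n : nat) : (2 ^ n.+1 = 2 ^ n + 2 ^ n)%N.
Proof. by rewrite expnS mul2n addnn. Qed.

(* The identification A_(n+1) = A_n x A_n: the first 2^n coordinates, then the
   last 2^n ones. *)
Definition cd_pair (R : realType) (n : nat) (a b : CD R n) : CD R n.+1 :=
  castmx (erefl, esym (expn2S n)) (row_mx a b).

Definition cd_fst (R : realType) (n : nat) (x : CD R n.+1) : CD R n :=
  lsubmx (castmx (erefl, expn2S n) x).

Definition cd_snd (R : realType) (n : nat) (x : CD R n.+1) : CD R n :=
  rsubmx (castmx (erefl, expn2S n) x).

Fixpoint cd_conj (R : realType) (n : nat) : CD R n -> CD R n :=
  match n return CD R n -> CD R n with
  | 0 => fun x => x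
  | n'.+1 => fun x => cd_pair (cd_conj (cd_fst x)) (- cd_snd x)
  end.

(* In degree 0 the vectors have a single coordinate, so the coordinatewise
   product is the product of R. *)
Fixpoint cd_mul (R : realType) (n : nat) : CD R n -> CD R n -> CD R n :=
  match n return CD R n -> CD R n -> CD R n with
  | 0 => fun x y => \row_i (x 0 i * y 0 i)
  | n'.+1 => fun u v =>
      let a := cd_fst u in let b := cd_snd u in
      let x := cd_fst v in let y := cd_snd v in
      cd_pair (cd_mul a x - cd_mul (cd_conj y) b)
              (cd_mul y a + cd_mul b (cd_conj x))
  end.

(* e_i, for i < 2^n (and 0 for larger i). *)
Definition cd_basis (R : realType) (n i : nat) : CD R n :=
  \row_j (j == i :> nat)%:R.

(* Euclidean, unlike the sup norm that the library puts on matrices. *)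
Definition dotp (R : realType) (k : nat) (u v : 'rV[R]_k) : R :=
  \sum_i u 0 i * v 0 i.

Definition enorm (R : realType) (k : nat) (u : 'rV[R]_k) : R :=
  Num.sqrt (dotp u u).

Definition cd_Im (R : realType) (n : nat) : set (CD R n) :=
  [set w | dotp w (cd_basis R n 0) = 0].

Definition cd_Im_sphere (R : realType) (n : nat) : set (CD R n) :=
  [set w | cd_Im w /\ enorm w = 1].

(* S^k, in R^(k+1). *)
Definition sphere (R : realType) (k : nat) : set 'rV[R]_k.+1 :=
  [set u | enorm u = 1].

Definition cd_mono (R : realType) (m n : nat) : set (CD R m -> CD R n) :=
  [set phi | [/\ linear phi, injective phi,
      phi (cd_basis R m 0) = cd_basis R n 0
    & forall x y, phi (cd_mul x y) = cd_mul (phi x) (phi y)]].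

Lemma cd_fst_pair (R : realType) (n : nat) (a b : CD R n) :
  cd_fst (cd_pair a b) = a.
Proof. by rewrite /cd_fst /cd_pair castmx_comp castmx_id row_mxKl. Qed.

Lemma cd_snd_pair (R : realType) (n : nat) (a b : CD R n) :
  cd_snd (cd_pair a b) = b.
Proof. by rewrite /cd_snd /cd_pair castmx_comp castmx_id row_mxKr. Qed.

Lemma cd_pairK (R : realType) (n : nat) (x : CD R n.+1) :
  cd_pair (cd_fst x) (cd_snd x) = x.
Proof.
by rewrite /cd_fst /cd_snd /cd_pair hsubmxK castmx_comp castmx_id.
Qed.

Lemma cd_conj_pair (R : realType) (n : nat) (a b : CD R n) :
  cd_conj (cd_pair a b) = cd_pair (cd_conj a) (- b).
Proof. by rewrite /= cd_fst_pair cd_snd_pair. Qed.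

Lemma cd_mul_pair (R : realType) (n : nat) (a b x y : CD R n) :
  cd_mul (cd_pair a b) (cd_pair x y)
  = cd_pair (cd_mul a x - cd_mul (cd_conj y) b)
            (cd_mul y a + cd_mul b (cd_conj x)).
Proof. by rewrite /= !cd_fst_pair !cd_snd_pair. Qed.

Lemma cd_basis_pairl (R : realType) (n i : nat) : (i < 2 ^ n)%N ->
  cd_basis R n.+1 i = cd_pair (cd_basis R n i) 0.
Proof.
move=> lt_i; rewrite -[LHS]cd_pairK; congr cd_pair; apply/rowP=> j;
  rewrite !mxE castmxE !mxE //=.
by rewrite gtn_eqF // (leq_trans lt_i) // leq_addr.
Qed.

Lemma cd_basis_pairr (R : realType) (n i : nat) :
  cd_basis R n.+1 (2 ^ n + i) = cd_pair 0 (cd_basis R n i).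
Proof.
rewrite -[LHS]cd_pairK; congr cd_pair; apply/rowP=> j;
  rewrite !mxE castmxE !mxE /=.
  by rewrite ltn_eqF // (leq_trans (ltn_ord j)) // leq_addr.
by rewrite eqn_add2l.
Qed.

(* Main.v *)
(** Every [x] of [A_n] satisfies [x + conj x = 2 <x, e_0> e_0] and
    [x (conj x) = |x|^2 e_0], hence [x^2 = 2 <x, e_0> x - |x|^2 e_0].
    As [A_1] is spanned by [e_0] and [e_1], a monomorphism amounts to the choice
    of [w], the image of [e_1], with [w^2 = - e_0] and [w] not a multiple of
    [e_0]; by the quadratic equation these are the [w] with [<w, e_0> = 0] and
    [|w| = 1]. *)
Require Import Defs.
From HB Require Import structures.
From mathcomp Require Import all_boot all_order all_algebra.
From mathcomp Require Import classical_sets functions reals.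
From mathcomp Require Import boolp.

Import Order.TTheory GRing.Theory Num.Theory.
Local Open Scope classical_set_scope.
Local Open Scope ring_scope.

(** * The Euclidean inner product on row vectors *)

Section Dot.
Context {R : realType} {k : nat}.
Implicit Types u v w : 'rV[R]_k.

Lemma dotpC u v : dotp u v = dotp v u.
Proof. by apply: eq_bigr => i _; rewrite mulrC. Qed.

Lemma dotp_linearl a u v w : dotp (a *: u + v) w = a * dotp u w + dotp v w.
Proof.
rewrite /dotp mulr_sumr -big_split /=; apply: eq_bigr => i _.
by rewrite !mxE mulrDl mulrA.
Qed.

Lemma dotp0l w : dotp 0 w = 0.
Proof. by rewrite /dotp big1 // => i _; rewrite mxE mul0r. Qed.

Lemma dotpZl a u w : dotp (a *: u) w = a * dotp u w.
Proof. by rewrite -[a *: u]addr0 dotp_linearl dotp0l addr0. Qed.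

Lemma enorm_eq1 u : enorm u = 1 <-> dotp u u = 1.
Proof.
rewrite /enorm; split=> [nu|->]; last by rewrite sqrtr1.
have uu_ge0 : 0 <= dotp u u by apply: sumr_ge0 => i _; rewrite -expr2 sqr_ge0.
by rewrite -(sqr_sqrtr uu_ge0) nu expr1n.
Qed.

End Dot.

Lemma dotp_row_mx (R : realType) (p q : nat) (a c : 'rV[R]_p) (b d : 'rV[R]_q) :
  dotp (row_mx a b) (row_mx c d) = dotp a c + dotp b d.
Proof.
by rewrite /dotp big_split_ord /=; congr (_ + _); apply: eq_bigr => i _;
  rewrite ?row_mxEl ?row_mxEr.
Qed.

(** With [q] a variable, [E] can be eliminated and the casts become identities; this is impossible
    for the concrete equation [expn2S n]. *)
Lemma dotp_castmx (R : realType) (p q : nat) (E : p = q) (u v : 'rV[R]_p) :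
  dotp (castmx (erefl, E) u) (castmx (erefl, E) v) = dotp u v.
Proof. by case: q / E; rewrite !castmx_id. Qed.

Lemma castmx_linear (R : realType) (p q : nat) (E : p = q) a (u v : 'rV[R]_p) :
  castmx (erefl, E) (a *: u + v)
  = a *: castmx (erefl, E) u + castmx (erefl, E) v.
Proof. by case: q / E; rewrite !castmx_id. Qed.

(** * Conjugation, product and squares in the Cayley-Dickson algebras *)

Section CayleyDickson.
Context {R : realType}.

Lemma cd_pair_linear {n : nat} t (a b c d : 'rV[R]_(2 ^ n)) :
  t *: cd_pair a b + cd_pair c d = cd_pair (t *: a + c) (t *: b + d).
Proof. by rewrite /cd_pair -castmx_linear scale_row_mx add_row_mx. Qed.

Lemma cd_pairD {n : nat} (a b c d : 'rV[R]_(2 ^ n)) :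
  cd_pair a b + cd_pair c d = cd_pair (a + c) (b + d).
Proof. by rewrite -[cd_pair a b]scale1r cd_pair_linear !scale1r. Qed.

Lemma cd_pair0 {n : nat} : cd_pair 0 0 = 0 :> 'rV[R]_(2 ^ n.+1).
Proof. by apply: (addrI (cd_pair 0 0)); rewrite cd_pairD !addr0. Qed.

Lemma cd_pairZ {n : nat} t (a b : 'rV[R]_(2 ^ n)) :
  t *: cd_pair a b = cd_pair (t *: a) (t *: b).
Proof. by rewrite -[LHS]addr0 -cd_pair0 cd_pair_linear !addr0. Qed.

Lemma cd_pairP {n : nat} (x : 'rV[R]_(2 ^ n.+1)) :
  exists a b, x = cd_pair a b.
Proof. by exists (cd_fst x), (cd_snd x); rewrite cd_pairK. Qed.

Lemma dotp_pair {n : nat} (a b c d : 'rV[R]_(2 ^ n)) :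
  dotp (cd_pair a b) (cd_pair c d) = dotp a c + dotp b d.
Proof. by rewrite dotp_castmx dotp_row_mx. Qed.

Lemma cd_basis0S (n : nat) : cd_basis R n.+1 0 = cd_pair (cd_basis R n 0) 0.
Proof. by rewrite cd_basis_pairl // expn_gt0. Qed.

Lemma dotp_basis {n : nat} (x : 'rV[R]_(2 ^ n)) (i : 'I_(2 ^ n)) :
  dotp x (cd_basis R n i) = x 0 i.
Proof.
rewrite /dotp (bigD1 i) //= big1 => [|j /negbTE ji].
  by rewrite mxE eqxx mulr1 addr0.
by rewrite mxE (inj_eq val_inj) ji mulr0.
Qed.

Lemma dotp_basis0 (n : nat) : dotp (cd_basis R n 0) (cd_basis R n 0) = 1.
Proof.
have n_gt0 : (0 < 2 ^ n)%N by rewrite expn_gt0.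
by have := dotp_basis (cd_basis R n 0) (Ordinal n_gt0); rewrite mxE.
Qed.

Lemma cd_conj_linear {n : nat} t (x y : 'rV[R]_(2 ^ n)) :
  cd_conj (t *: x + y) = t *: cd_conj x + cd_conj y.
Proof.
elim: n x y => [//|n IHn] x y.
have [[a [b ->]] [c [d ->]]] := (cd_pairP x, cd_pairP y).
rewrite cd_pair_linear !cd_conj_pair cd_pair_linear IHn.
by rewrite opprD scalerN.
Qed.

(** The recursion only negates second components, while the coordinate along [e_0] always sits in
    the first one. So conjugation fixes [e_0] and negates its orthogonal complement. *)
Lemma cd_conjE {n : nat} (x : 'rV[R]_(2 ^ n)) :
  cd_conj x = (2 * dotp x (cd_basis R n 0)) *: cd_basis R n 0 - x.
Proof.
elim: n x => [|n IHn] x.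
  apply/rowP=> i; rewrite /dotp (big_ord_recl 0) big_ord0 !mxE (ord1 i) /=.
  by rewrite !mulr1 addr0 mulr_natl mulr2n addrK.
have [a [b ->]] := cd_pairP x.
rewrite cd_conj_pair IHn cd_basis0S dotp_pair dotpC (dotpC b) dotp0l addr0.
by rewrite cd_pairZ -(scaleN1r (cd_pair a b)) cd_pairZ cd_pairD !scaleN1r
  scaler0 add0r dotpC.
Qed.

(** The product of pairs swaps the order of some factors, so linearity on one side in degree [n.+1]
    calls for linearity on both sides in degree [n]: the two go through one induction. *)
Lemma cd_mul_bilinear {n : nat} t (x y z : 'rV[R]_(2 ^ n)) :
  cd_mul (t *: x + y) z = t *: cd_mul x z + cd_mul y z
  /\ cd_mul z (t *: x + y) = t *: cd_mul z x + cd_mul z y.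
Proof.
elim: n t x y z => [|n IHn] t x y z.
  split; apply/rowP=> i; rewrite !mxE; first by rewrite mulrDl mulrA.
  by rewrite mulrDr mulrCA.
have [[a [b ->]] [c [d ->]]] := (cd_pairP x, cd_pairP y).
have [p [q ->]] := cd_pairP z.
have L (u v w : 'rV_(2 ^ n)) :
    cd_mul (t *: u + v) w = t *: cd_mul u w + cd_mul v w.
  exact: (IHn _ _ _ _).1.
have M (u v w : 'rV_(2 ^ n)) :
    cd_mul w (t *: u + v) = t *: cd_mul w u + cd_mul w v.
  exact: (IHn _ _ _ _).2.
rewrite cd_pair_linear !cd_mul_pair !cd_pair_linear !cd_conj_linear !L !M.
by split; congr cd_pair; rewrite ?scalerBr ?scalerDr ?opprD addrACA.
Qed.

Lemma cd_mul_linearl {n : nat} t (x y z : 'rV[R]_(2 ^ n)) :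
  cd_mul (t *: x + y) z = t *: cd_mul x z + cd_mul y z.
Proof. exact: (cd_mul_bilinear t x y z).1. Qed.

Lemma cd_mul_linearr {n : nat} t (x y z : 'rV[R]_(2 ^ n)) :
  cd_mul z (t *: x + y) = t *: cd_mul z x + cd_mul z y.
Proof. exact: (cd_mul_bilinear t x y z).2. Qed.

Lemma cd_mul0l {n : nat} (z : 'rV[R]_(2 ^ n)) : cd_mul 0 z = 0.
Proof.
(* With coefficient -1 the two terms on the right cancel, while the left argument is still 0. *)
by have := cd_mul_linearl (-1) 0 0 z; rewrite scaler0 addr0 scaleN1r addNr.
Qed.

Lemma cd_mul0r {n : nat} (z : 'rV[R]_(2 ^ n)) : cd_mul z 0 = 0.
Proof.
by have := cd_mul_linearr (-1) 0 0 z; rewrite scaler0 addr0 scaleN1r addNr.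
Qed.

Lemma cd_mulNl {n : nat} (x z : 'rV[R]_(2 ^ n)) :
  cd_mul (- x) z = - cd_mul x z.
Proof.
by have := cd_mul_linearl (-1) x 0 z; rewrite cd_mul0l !addr0 !scaleN1r.
Qed.

Lemma cd_mulNr {n : nat} (x z : 'rV[R]_(2 ^ n)) :
  cd_mul z (- x) = - cd_mul z x.
Proof.
by have := cd_mul_linearr (-1) x 0 z; rewrite cd_mul0r !addr0 !scaleN1r.
Qed.

Lemma cd_mulZr {n : nat} t (x z : 'rV[R]_(2 ^ n)) :
  cd_mul z (t *: x) = t *: cd_mul z x.
Proof. by rewrite -[t *: x]addr0 cd_mul_linearr cd_mul0r addr0. Qed.

Lemma cd_conj_basis0 (n : nat) : cd_conj (cd_basis R n 0) = cd_basis R n 0.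
Proof. by rewrite cd_conjE dotp_basis0 mulr1 scaler_nat mulr2n addrK. Qed.

Lemma cd_conj0 {n : nat} : cd_conj 0 = 0 :> 'rV[R]_(2 ^ n).
Proof. by rewrite cd_conjE dotp0l mulr0 scale0r subr0. Qed.

(** A joint induction again: [e_0 (a, b) = (e_0 a, b e_0)] involves both unit laws of the lower
    degree. *)
Lemma cd_mul1_both {n : nat} (x : 'rV[R]_(2 ^ n)) :
  cd_mul (cd_basis R n 0) x = x /\ cd_mul x (cd_basis R n 0) = x.
Proof.
elim: n x => [|n IHn] x.
  by split; apply/rowP=> i; rewrite !mxE (ord1 i) ?mul1r ?mulr1.
have [a [b ->]] := cd_pairP x.
rewrite cd_basis0S !cd_mul_pair cd_conj_basis0 cd_conj0 !cd_mul0l !cd_mul0r.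
by rewrite !(IHn _).1 !(IHn _).2 !subr0 add0r addr0.
Qed.

Lemma cd_mul1l {n : nat} (x : 'rV[R]_(2 ^ n)) : cd_mul (cd_basis R n 0) x = x.
Proof. exact: (cd_mul1_both x).1. Qed.

Lemma cd_mul1r {n : nat} (x : 'rV[R]_(2 ^ n)) : cd_mul x (cd_basis R n 0) = x.
Proof. exact: (cd_mul1_both x).2. Qed.

(** On a pair [(a, b)] the second component is [b (conj a) - b (conj a) = 0], and the first is
    [(conj a) a + (conj b) b], to which the induction hypothesis applies. *)
Lemma cd_conj_mul {n : nat} (x : 'rV[R]_(2 ^ n)) :
  cd_mul (cd_conj x) x = dotp x x *: cd_basis R n 0.
Proof.
elim: n x => [|n IHn] x.
  by apply/rowP=> i; rewrite /dotp (big_ord_recl 0) big_ord0 !mxE (ord1 i) /=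
    addr0 mulr1.
have [a [b ->]] := cd_pairP x.
rewrite cd_conj_pair cd_mul_pair cd_mulNr cd_mulNl opprK !IHn addrN.
by rewrite dotp_pair cd_basis0S cd_pairZ scaler0 scalerDl.
Qed.

Lemma cd_mul_self {n : nat} (x : 'rV[R]_(2 ^ n)) :
  cd_mul x x
  = (2 * dotp x (cd_basis R n 0)) *: x - dotp x x *: cd_basis R n 0.
Proof.
rewrite -cd_conj_mul cd_conjE cd_mul_linearl cd_mul1l cd_mulNl.
by rewrite opprD opprK addNKr.
Qed.

Lemma cd_Im_sphereP {n : nat} (w : 'rV[R]_(2 ^ n)) :
  cd_Im_sphere w <-> dotp w (cd_basis R n 0) = 0 /\ dotp w w = 1.
Proof. by split=> -[w0 w1]; split=> //; apply/enorm_eq1. Qed.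

Lemma cd_mul_sphere {n : nat} (w : 'rV[R]_(2 ^ n)) :
  cd_Im_sphere w -> cd_mul w w = - cd_basis R n 0.
Proof.
by move=> /cd_Im_sphereP[w0 w1]; rewrite cd_mul_self w0 w1 mulr0 scale0r sub0r
  scale1r.
Qed.

(** With [t = <w, e_0>], the quadratic equation turns [w^2 = - e_0] into [2 t w = (|w|^2 - 1) e_0].
    If [t] were nonzero, [w] would be a multiple of [e_0]; hence [t = 0], and then [|w|^2 = 1]. *)
Lemma cd_sphere_of_square {n : nat} (w : 'rV[R]_(2 ^ n)) :
  (forall t, w <> t *: cd_basis R n 0) ->
  cd_mul w w = - cd_basis R n 0 -> cd_Im_sphere w.
Proof.
move=> w_free ww; apply/cd_Im_sphereP.
set t := dotp w _; have eq_w : (2 * t) *: w = (dotp w w - 1) *: cd_basis R n 0.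
  by rewrite scalerBl scale1r -ww cd_mul_self addrC subrK.
have [t0|t_neq0] := eqVneq t 0.
  split=> //; have := congr1 (fun u => dotp u (cd_basis R n 0)) eq_w.
  rewrite !dotpZl dotp_basis0 t0 !mulr0 mul0r mulr1 => /esym/eqP.
  by rewrite subr_eq0 => /eqP.
have t2 : 2 * t != 0 by rewrite mulf_neq0 // pnatr_eq0.
case: (w_free ((2 * t)^-1 * (dotp w w - 1))).
by rewrite -scalerA -eq_w scalerK.
Qed.

(** * Monomorphisms from A_1 and the unit sphere of pure elements *)

Lemma cd1_decomp (x : 'rV[R]_(2 ^ 1)) :
  x = dotp x (cd_basis R 1 0) *: cd_basis R 1 0
      + dotp x (cd_basis R 1 1) *: cd_basis R 1 1.
Proof.
have x0 := dotp_basis x (Ordinal (isT : 0 < 2 ^ 1)%N).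
have x1 := dotp_basis x (Ordinal (isT : 1 < 2 ^ 1)%N).
apply/rowP=> i; rewrite x0 x1 !mxE.
by case: i => -[|[|//]] lt_i /=; rewrite !mulr0 !mulr1 ?addr0 ?add0r;
  congr (x _ _); apply: val_inj.
Qed.

Lemma cd_basis1_sphere : cd_Im_sphere (cd_basis R 1 1).
Proof.
apply/cd_Im_sphereP.
have e10 := dotp_basis (cd_basis R 1 1) (Ordinal (isT : 0 < 2 ^ 1)%N).
have e11 := dotp_basis (cd_basis R 1 1) (Ordinal (isT : 1 < 2 ^ 1)%N).
by rewrite e10 e11 !mxE.
Qed.

Lemma cd_mono_sphere {n : nat} (phi : 'rV[R]_(2 ^ 1) -> 'rV[R]_(2 ^ n)) :
  cd_mono phi -> cd_Im_sphere (phi (cd_basis R 1 1)).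
Proof.
case=> lin inj phi0 phiM.
have phi_0 : phi 0 = 0.
  by have := lin (-1) 0 0; rewrite scaler0 addr0 scaleN1r addNr.
have phiZ t x : phi (t *: x) = t *: phi x.
  by rewrite -[t *: x]addr0 lin phi_0 addr0.
have /cd_Im_sphereP[e10 e11] := cd_basis1_sphere.
apply: cd_sphere_of_square => [t|].
  (* Injectivity would give [e_1 = t e_0], hence [<e_1, e_1> = t <e_0, e_1> = 0], against [e11]. *)
  rewrite -phi0 -phiZ => /inj e1E; move: e11.
  rewrite [X in dotp _ X]e1E dotpC dotpZl dotpC e10 mulr0 => /esym/eqP.
  by rewrite oner_eq0.
rewrite -phiM cd_mul_sphere; last exact: cd_basis1_sphere.
by rewrite -scaleN1r phiZ phi0 scaleN1r.
Qed.

(** The inverse of evaluation at [e_1]: the linear map sending [e_0] to [e_0] and [e_1] to [w]. *)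
Definition cd1_ext {n : nat} (w : 'rV[R]_(2 ^ n)) (x : 'rV[R]_(2 ^ 1)) :=
  dotp x (cd_basis R 1 0) *: cd_basis R n 0 + dotp x (cd_basis R 1 1) *: w.

Lemma cd1_ext_basis {n : nat} (w : 'rV[R]_(2 ^ n)) a b :
  cd1_ext w (a *: cd_basis R 1 0 + b *: cd_basis R 1 1)
  = a *: cd_basis R n 0 + b *: w.
Proof.
have /cd_Im_sphereP[e10 e11] := cd_basis1_sphere.
rewrite /cd1_ext !dotp_linearl !dotpZl e10 e11 dotp_basis0 dotpC e10.
by rewrite !mulr0 !mulr1 addr0 add0r.
Qed.

Lemma cd1_ext1 {n : nat} (w : 'rV[R]_(2 ^ n)) : cd1_ext w (cd_basis R 1 1) = w.
Proof.
by have := cd1_ext_basis w 0 1; rewrite !scale0r !scale1r !add0r.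
Qed.

(** Since [w^2 = - e_0], the plane spanned by [e_0] and [w] multiplies like the complex numbers. *)
Lemma cd_mul_span {n : nat} (w : 'rV[R]_(2 ^ n)) a b c d :
  cd_Im_sphere w ->
  cd_mul (a *: cd_basis R n 0 + b *: w) (c *: cd_basis R n 0 + d *: w)
  = (a * c - b * d) *: cd_basis R n 0 + (a * d + b * c) *: w.
Proof.
move=> Sw; rewrite cd_mul_linearl cd_mul1l cd_mul_linearr cd_mul1r cd_mulZr.
have -> : cd_mul (b *: w) w = - b *: cd_basis R n 0.
  have := cd_mul_linearl b w 0 w.
  by rewrite cd_mul0l !addr0 cd_mul_sphere // scalerN scaleNr.
rewrite scalerDr !scalerA mulrN (mulrC d) (mulrC c) scalerBl scalerDl scaleNr.
by rewrite [X in _ + X = _]addrC addrACA.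
Qed.

Lemma cd1_ext_mono {n : nat} (w : 'rV[R]_(2 ^ n)) :
  cd_Im_sphere w -> cd_mono (cd1_ext w).
Proof.
move=> Sw; have /cd_Im_sphereP[w0 w1] := Sw; split.
- move=> t x y; rewrite /cd1_ext !dotp_linearl !scalerDl scalerDr !scalerA.
  by rewrite addrACA.
- move=> x y xy; rewrite (cd1_decomp x) (cd1_decomp y).
  (* As [e_0] and [w] are orthonormal, inner products with them recover both coordinates of the
     argument. *)
  have ext0 z : dotp (cd1_ext w z) (cd_basis R n 0) = dotp z (cd_basis R 1 0).
    by rewrite dotp_linearl dotpZl w0 dotp_basis0 mulr1 mulr0 addr0.
  have ext1 z : dotp (cd1_ext w z) w = dotp z (cd_basis R 1 1).
    by rewrite dotp_linearl dotpZl w1 (dotpC _ w) w0 mulr1 mulr0 add0r.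
  by rewrite -!ext0 -!ext1 xy.
- by have := cd1_ext_basis w 1 0; rewrite !scale0r !scale1r !addr0.
- move=> x y; rewrite (cd1_decomp x) (cd1_decomp y).
  (* The same product formula serves twice: in A_1 with [e_1], then in A_n with [w]. *)
  rewrite (cd_mul_span _ _ _ _ _ cd_basis1_sphere) !cd1_ext_basis.
  by rewrite cd_mul_span.
Qed.

Lemma cd1_mono_bij (n : nat) :
  set_bij (@cd_mono R 1 n) (@cd_Im_sphere R n) (fun phi => phi (cd_basis R 1 1)).
Proof.
split.
- by move=> phi; exact: cd_mono_sphere.
- move=> phi psi /set_mem[lin _ phi0 _] /set_mem[lin' _ psi0 _] eq1.
  have add0 (f : 'rV[R]_(2 ^ 1) -> 'rV[R]_(2 ^ n)) : linear f -> f 0 = 0.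
    by move=> lf; have := lf (-1) 0 0; rewrite scaler0 addr0 scaleN1r addNr.
  apply/funext=> x; rewrite (cd1_decomp x) lin lin' phi0 psi0.
  rewrite -[dotp x (cd_basis R 1 1) *: _]addr0 lin lin' (add0 _ lin).
  by rewrite (add0 _ lin') eq1.
- move=> w Sw; exists (cd1_ext w); first exact: cd1_ext_mono.
  exact: cd1_ext1.
Qed.

End CayleyDickson.

(** * Isometric parametrization of the pure elements *)

Section ImEmbedding.
Context {R : realType} {m k : nat}.
Context (E : (1 + k = m)%N).

Definition prepend0 (u : 'rV[R]_k) : 'rV[R]_m :=
  castmx (erefl, E) (row_mx (0 : 'rV_1) u).

Lemma prepend0_linear : linear prepend0.
Proof.
move=> t u v; rewrite /prepend0 -castmx_linear scale_row_mx add_row_mx.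
by rewrite scaler0 addr0.
Qed.

Lemma dotp_prepend0 u v : dotp (prepend0 u) (prepend0 v) = dotp u v.
Proof. by rewrite dotp_castmx dotp_row_mx dotp0l add0r. Qed.

(** Orthogonality to the first basis vector says that the first coordinate vanishes. That vector is
    spelled out because [m] is an arbitrary dimension; for [m = 2 ^ n] it unfolds from
    [cd_basis R n 0]. *)
Lemma range_prepend0 :
  range prepend0 = [set w | dotp w (\row_j (j == 0 :> nat)%:R) = 0].
Proof.
rewrite /prepend0; case: m / E; set e := \row_j _.
have -> : e = row_mx (const_mx 1) 0.
  apply/rowP=> j; rewrite !mxE; case: splitP => i ->; rewrite !mxE //.
  by rewrite (ord1 i).
apply/seteqP; split=> [_ [u _ <-]|w] /=.
  by rewrite castmx_id dotp_row_mx dotp0l dotpC dotp0l addr0.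
rewrite -[w]hsubmxK dotp_row_mx (dotpC _ 0) dotp0l addr0 => w0.
exists (rsubmx w) => //; rewrite castmx_id; congr row_mx.
apply/rowP=> i; rewrite (ord1 i) mxE -w0 /dotp (big_ord_recl 0) big_ord0 addr0.
by rewrite [const_mx _ _ _]mxE mulr1.
Qed.

End ImEmbedding.

Theorem proposition2p1 (R : realType) (n : nat) (n_ge1 : (1 <= n)%N) :
  set_bij (@cd_mono R 1 n) (@cd_Im_sphere R n)
    (fun phi => phi (cd_basis R 1 1))
  /\ exists h : {linear 'rV[R]_(2 ^ n - 2).+1 -> 'rV[R]_(2 ^ n)},
      [/\ forall u v, dotp (h u) (h v) = dotp u v,
          range h = @cd_Im R n
        & h @` @sphere R (2 ^ n - 2) = @cd_Im_sphere R n].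
Proof.
split; first exact: cd1_mono_bij.
(* From [n_ge1], [2 <= 2 ^ n], so the truncated subtraction is exact. *)
have E : (1 + (2 ^ n - 2).+1 = 2 ^ n)%N.
  by rewrite add1n -addn2 subnK // (leq_pexp2l _ n_ge1).
pose hL := GRing.isLinear.Build R _ _ _ (@prepend0 R _ _ E) (prepend0_linear E).
pose h : {linear 'rV[R]_(2 ^ n - 2).+1 -> 'rV[R]_(2 ^ n)} :=
  HB.pack (@prepend0 R _ _ E) hL.
have hD u v : dotp (h u) (h v) = dotp u v by exact: dotp_prepend0.
have hR : range h = @cd_Im R n by exact: range_prepend0.
exists h; split=> //; apply/seteqP; split=> [_ [u Su <-]|w [Iw Nw]].
  by split; [rewrite -hR; exists u | rewrite /enorm hD].
(* A pure [w] has a preimage under [h], whose norm is also 1 because [h] is an isometry. *)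
move: Iw; rewrite -hR => -[u _ hu]; exists u => //.
by rewrite /sphere /= /enorm -hD hu.
Qed.
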